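(* Let $T$ be a finite tree and $w$ a positive weight function on $V(T)$. Let $C$ be a non-$w$-coverable simple configuration on $T$ of maximum size (among the non-$w$-coverable simple configurations on $T$), with $\sigma(C)=\{v\}$. Then $v$ is a leaf (that is, an endpoint) of a longest path in $T$.
   Context: A configuration $C$ of pebbles on a graph $G$ assigns a nonnegative integer number $C(v)$ of pebbles to each vertex $v$; its size $|C|$ is the total number of pebbles, and its support $\sigma(C)$ is the set of vertices $v$ with $C(v)>0$. A configuration is simple if its support consists of a single vertex. A pebbling move consists of taking two pebbles off of one vertex (which must have at least two) and placing one pebble on an adjacent vertex. A weight function $w$ assigns an integer $w(v)$ to each vertex $v$; it is positive if $w(v)>0$ for all $v$. A configuration is $w$-coverable if there is a (possibly empty) sequence of pebbling moves starting from it after which every vertex $v$ simultaneously has at least $w(v)$ pebbles on it, and non-$w$-coverable otherwise. A longest path is a path in $T$ with the maximum number of edges (the weights play no role in its length). *)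

(* Defs.v *)
From mathcomp Require Import all_boot all_order all_algebra.
Set Implicit Arguments.
Unset Strict Implicit.
Unset Printing Implicit Defensive.
Import Order.TTheory GRing.Theory Num.Theory.

Section Graph.
Variables (T : finType) (e : rel T).

Definition is_simple_graph := symmetric e /\ irreflexive e.

Definition is_connected := 0 < #|T| /\ forall x y : T, connect e x y.

(* The bound on the size excludes the closed walks x, y, x along an edge,
   which [ucycle] accepts since [e] is symmetric. *)
Definition is_acyclic := forall c : seq T, ucycle e c -> size c < 3.

Definition is_tree := [/\ is_simple_graph, is_connected & is_acyclic].

(* The path with vertices x :: p, which has size p edges. *)
Definition is_path (x : T) (p : seq T) := path e x p && uniq (x :: p).

Definition is_longest_path (x : T) (p : seq T) :=
  is_path x p /\ forall y q, is_path y q -> size q <= size p.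

Definition endpoint (x : T) (p : seq T) (v : T) := v = x \/ v = last x p.

Definition config := {ffun T -> nat}.

Definition config_size (C : config) : nat := \sum_v C v.

Definition config_support (C : config) : {set T} := [set v | 0 < C v].

Definition simple_config (C : config) := exists v, config_support C = [set v].

Definition move_result (C : config) (x y : T) : config :=
  [ffun z => C z - 2 * (z == x) + (z == y)].

Definition pebbling_move : rel config := fun C C' =>
  [exists x, exists y, [&& e x y, 2 <= C x & C' == move_result C x y]].

Definition weight := T -> int.

Definition positive_weight (w : weight) := forall v, (0 < w v)%R.

Definition covers (w : weight) (C : config) := forall v, (w v <= (C v)%:Z)%R.

Definition coverable (w : weight) (C : config) :=
  exists s : seq config, path pebbling_move C s /\ covers w (last C s).

Definition noncoverable_simple (w : weight) (C : config) :=
  simple_config C /\ ~ coverable w C.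

Definition max_noncoverable_simple (w : weight) (C : config) :=
  noncoverable_simple w C /\
  forall C', noncoverable_simple w C' -> config_size C' <= config_size C.

End Graph.

(* Main.v *)
(* Put s(v) = sum_u w(u) 2^d(u,v).  Since a move towards an adjacent vertex at
   best preserves sum_z C(z) 2^d(z,v), a simple configuration on v is coverable
   iff it has at least s(v) pebbles.  A maximum non-coverable simple
   configuration on v therefore forces s(v) to be maximum.

   Let a and b be the ends of a longest path and suppose that v is not an end of
   any longest path.  If x is the vertex of the path from a to b closest to v,
   then d(v,x) < d(a,x) and d(v,x) < d(b,x).  For every u, the path from u to a
   or the path from u to b runs through x, so d(u,v) < max(d(u,a), d(u,b)).
   Hence 2^d(u,a) + 2^d(u,b) > 2 * 2^d(u,v) for every u, and summing with the
   weights gives s(a) + s(b) > 2 s(v), against the maximality of s(v). *)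
Require Import Defs.
From mathcomp Require Import all_boot all_order all_algebra.
From mathcomp Require Import zify.
Set Implicit Arguments.
Unset Strict Implicit.
Unset Printing Implicit Defensive.

(** * Unique paths and distances in a tree *)

Section TreeDistance.
Variables (T : finType) (e : rel T).
Hypothesis tree_e : is_tree e.

Let sym_e : symmetric e. Proof. by case: tree_e => -[]. Qed.

Lemma is_path_rev x p :
  is_path e x p -> is_path e (last x p) (rev (belast x p)).
Proof.
case/andP=> xp uxp; apply/andP; split.
  by rewrite rev_path (eq_path (e' := e)) // => y z; rewrite sym_e.
by rewrite -rev_rcons -lastI rev_uniq.
Qed.

(* Otherwise the two paths, followed from [x] up to the first vertex of [p]
   lying on [q], would close up to a cycle. *)
Lemma is_path_heads x p q : is_path e x p -> is_path e x q ->
  last x p = last x q -> p != [::] -> head x p = head x q.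
Proof.
case/andP=> xp; rewrite cons_uniq => /andP[xNp up].
case/andP=> xq; rewrite cons_uniq => /andP[xNq uq] eq_last p0.
have hasp : has (mem q) p.
  case: p p0 xNp {xp up} eq_last => //= y p _ yNp eq_last.
  case: q eq_last {xq xNq uq} => [|z q] /= eq_last.
    by case/negP: yNp; rewrite -eq_last mem_last.
  apply/(@hasP _ (mem (z :: q)) (y :: p)).
  exists (last y p); first exact: mem_last.
  by rewrite eq_last; apply: mem_last.
case/split_find: hasp xp up xNp {p0 eq_last} => z p1 p2 /= zq Np1q xp up xNp.
case/path.splitP: zq xq uq xNq Np1q => q1 q2 xq uq xNq Np1q.
move: xp xq; rewrite !cat_path => /andP[xp _] /andP[xq _].
case: tree_e => _ _ /(_ (x :: rcons p1 z ++ rev q1)) acyc.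
(* A cycle of size below 3 leaves [p1] and [q1] empty, so both heads are [z]. *)
suff /acyc : ucycle e (x :: rcons p1 z ++ rev q1).
  rewrite /= size_cat size_rcons size_rev.
  by case: p1 {acyc up xNp Np1q xp} => //; case: q1 {uq xNq xq}.
apply/andP; split.
  rewrite /= rcons_cat -rev_cons cat_path xp last_rcons /=.
  have := rev_path e x (rcons q1 z); rewrite last_rcons belast_rcons => ->.
  by rewrite (eq_path (e' := e)) // => y t; rewrite sym_e.
move: up uq xNp xNq Np1q; rewrite !cat_uniq => /andP[up _] /andP[uq _].
rewrite !mem_cat !negb_or => /andP[xNp _] /andP[xNq _] Np1q.
rewrite cons_uniq mem_cat mem_rev negb_or xNp cat_uniq up rev_uniq /=.
move: uq xNq; rewrite rcons_uniq mem_rcons inE negb_or.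
move=> /andP[zNq1 uq1] /andP[_ ->].
rewrite uq1 andbT; apply/hasPn => t; rewrite mem_rev => tq1 /=.
rewrite mem_rcons inE negb_or; apply/andP; split.
  by apply: contraNneq zNq1 => <-.
apply: contra Np1q => tp1; apply/hasP; exists t => //=.
by rewrite mem_cat mem_rcons inE tq1 orbT.
Qed.

Lemma is_path_closed x p : is_path e x p -> last x p = x -> p = [::].
Proof.
case: p => //= y p /andP[_] /andP[/negP xNp _] eq_last; case: xNp.
by rewrite -eq_last mem_last.
Qed.

Lemma is_path_inj x p q :
  is_path e x p -> is_path e x q -> last x p = last x q -> p = q.
Proof.
elim: p x q => [|y p IH] x q xp xq eq_last.
  by rewrite (is_path_closed xq).
case: q xq eq_last => [|z q] xq eq_last.
  by have := is_path_closed xp eq_last.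
have /= yz := is_path_heads xp xq eq_last isT; rewrite -yz in xq eq_last *.
congr (_ :: _); case/andP: xp => /= /andP[_ yp] /andP[_ uyp].
case/andP: xq => /= /andP[_ yq] /andP[_ uyq].
by apply: (IH y) => //; apply/andP.
Qed.

Lemma tpath_exists x y : exists p, is_path e x p && (last x p == y).
Proof.
case: tree_e => _ [_ /(_ x y) /connectP[p xp ->]] _.
by case/shortenP: xp => q xq uq _; exists q; rewrite /is_path xq uq eqxx.
Qed.

Definition tpath x y := xchoose (tpath_exists x y).
Definition dist x y := size (tpath x y).

Lemma tpath_is_path x y : is_path e x (tpath x y).
Proof. by case/andP: (xchooseP (tpath_exists x y)). Qed.

Lemma last_tpath x y : last x (tpath x y) = y.
Proof. by case/andP: (xchooseP (tpath_exists x y)) => _ /eqP. Qed.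

Lemma tpath_last x p : is_path e x p -> tpath x (last x p) = p.
Proof.
by move=> xp; apply: (is_path_inj (tpath_is_path _ _) xp); rewrite last_tpath.
Qed.

Lemma dist_last x p : is_path e x p -> dist x (last x p) = size p.
Proof. by move=> xp; rewrite /dist tpath_last. Qed.

Lemma dist_walk x p : path e x p -> dist x (last x p) <= size p.
Proof.
case/shortenP=> q xq uq sqp; rewrite dist_last /is_path ?xq //.
by apply: uniq_leq_size sqp; case/andP: uq.
Qed.

Lemma distxx x : dist x x = 0.
Proof. exact: (@dist_last x [::]). Qed.

Lemma dist_eq0 x y : dist x y = 0 -> x = y.
Proof. by rewrite -{2}(last_tpath x y) => /size0nil ->. Qed.

Lemma last_rev_belast x (p : seq T) : last (last x p) (rev (belast x p)) = x.
Proof. by case: p => //= y p; rewrite rev_cons last_rcons. Qed.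

Lemma tpathC x y : y :: tpath y x = rev (x :: tpath x y).
Proof.
have := tpath_last (is_path_rev (tpath_is_path x y)).
rewrite last_rev_belast last_tpath => ->.
by rewrite (lastI x) rev_rcons last_tpath.
Qed.

Lemma distC x y : dist x y = dist y x.
Proof. by have := congr1 size (tpathC x y); rewrite size_rev => -[]. Qed.

Lemma tpath_walk_cat x y z : path e x (tpath x y ++ tpath y z).
Proof.
rewrite cat_path last_tpath.
by case/andP: (tpath_is_path x y) => -> _; case/andP: (tpath_is_path y z).
Qed.

Lemma last_tpath_cat x y z : last x (tpath x y ++ tpath y z) = z.
Proof. by rewrite last_cat !last_tpath. Qed.

Lemma dist_triangle x y z : dist x z <= dist x y + dist y z.
Proof.
by have := dist_walk (tpath_walk_cat x y z); rewrite last_tpath_cat size_cat.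
Qed.

Lemma dist_edge v x y : e x y -> dist v y <= (dist v x).+1.
Proof.
move=> exy; apply: leq_trans (dist_triangle v x y) _.
by rewrite -addn1 leq_add2l (@dist_walk x [:: y]) //= exy.
Qed.

Lemma tpath_cat x y z :
  y \in x :: tpath x z -> tpath x z = tpath x y ++ tpath y z.
Proof.
have := tpath_is_path x z; have := last_tpath x z.
move: (tpath x z) => p lp xp xyp; case/splitPl: xyp xp lp => p1 p2 <- xp <-.
have /tpath_last -> : is_path e x p1.
  move: xp; rewrite /is_path cat_path -cat_cons cat_uniq.
  by case/andP=> /andP[-> _] /and3P[].
rewrite last_cat tpath_last //.
move: xp; rewrite /is_path cat_path -cat_cons lastI cat_rcons cat_uniq.
by case/andP=> /andP[_ ->] /and3P[].
Qed.

Lemma dist_tpath x y z :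
  y \in x :: tpath x z -> dist x z = dist x y + dist y z.
Proof. by move/tpath_cat=> xz; rewrite /dist xz size_cat. Qed.

(** Removing the loops from the walk through [y] only drops vertices, and by uniqueness what remains
    is [tpath x z]. *)
Lemma mem_tpath_via x y z t : t \in x :: tpath x z ->
  t \in x :: tpath x y \/ t \in y :: tpath y z.
Proof.
have := last_tpath_cat x y z.
case/shortenP: (tpath_walk_cat x y z) => p xp up sub lp.
rewrite -{}lp in sub *; rewrite tpath_last /is_path ?xp // => /predU1P[->|/sub].
  by left; rewrite inE eqxx.
by rewrite mem_cat => /orP[] tp; [left|right]; rewrite in_cons tp orbT.
Qed.

(** The walk from [v] through [x] to [b] is already a path: a vertex [z] met again after [x] would
    lie on [tpath a b], so minimality gives [dist z x = 0]. *)
Lemma dist_closest v a b x : x \in a :: tpath a b ->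
  (forall y, y \in a :: tpath a b -> dist v x <= dist v y) ->
  dist v b = dist v x + dist x b.
Proof.
move=> abx min_x; rewrite -{1}(last_tpath_cat v x b) dist_last ?size_cat //.
rewrite /is_path tpath_walk_cat -cat_cons cat_uniq.
case/andP: (tpath_is_path v x) => _ ->.
case/andP: (tpath_is_path x b) => _ /= /andP[xNxb ->].
rewrite andbT; apply/hasPn => z xbz; apply/negP => vxz.
have /min_x : z \in a :: tpath a b.
  by rewrite inE (tpath_cat abx) mem_cat xbz !orbT.
rewrite (dist_tpath vxz) -{2}[dist v z]addn0 leq_add2l leqn0.
move=> /eqP/dist_eq0 zx.
by rewrite -{1}zx xbz in xNxb.
Qed.

Lemma dist_eccentric a b v :
  (forall x y, dist x y <= dist a b) -> (forall y, dist v y < dist a b) ->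
  forall u, dist v u < dist a u \/ dist v u < dist b u.
Proof.
move=> diam ecc u.
have aab : a \in a :: tpath a b by rewrite inE eqxx.
case: (arg_minnP (dist v) aab) => x abx min_x.
have bax : x \in b :: tpath b a by rewrite tpathC mem_rev.
have vxb := dist_closest abx min_x.
have vxa : dist v a = dist v x + dist x a.
  apply: (dist_closest bax) => y.
  by rewrite tpathC mem_rev; apply: min_x.
have axb := dist_tpath abx; rewrite (distC a x) in axb.
(* With [axb], these bounds give [dist v x < dist x b] and [dist v x < dist a x]. *)
have va := ecc a; have vb := ecc b.
have vxu := dist_triangle v x u.
case: (mem_tpath_via u abx) => [/dist_tpath|].
  by rewrite (distC a x); left; lia.
by rewrite -mem_rev -tpathC => /dist_tpath; rewrite (distC b x); right; lia.
Qed.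

End TreeDistance.

(** * Carrying pebbles along paths *)

Section Attainable.
Variables (T : finType) (e : rel T).
Implicit Types (C : config T) (F G : T -> nat).

Definition attains C G :=
  exists s : seq (config T),
    path (pebbling_move e) C s /\ forall z, G z <= last C s z.

Lemma attains_refl C G : (forall z, G z <= C z) -> attains C G.
Proof. by exists [::]. Qed.

Lemma attains_trans C F G : attains C F ->
  (forall C', (forall z, F z <= C' z) -> attains C' G) -> attains C G.
Proof.
case=> s [Cs Fs] /(_ _ Fs) [t [st Gt]]; exists (s ++ t).
by rewrite cat_path Cs st last_cat.
Qed.

(** The frame [F] stands for pebbles set aside that the move leaves alone; it lets successive
    deliveries add up. *)
Lemma attains_move C F x y : e x y ->
  (forall z, F z + (z == x) * 2 <= C z) -> attains C (fun z => F z + (z == y)).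
Proof.
move=> exy FC; exists [:: move_result C x y]; split=> [|z] /=; last first.
  by rewrite ffunE; have := FC z; lia.
rewrite andbT; apply/existsP; exists x; apply/existsP; exists y.
by rewrite exy eqxx; have := FC x; rewrite eqxx andbT /=; lia.
Qed.

Lemma attains_edge m C F x y : e x y ->
  (forall z, F z + (z == x) * (m * 2) <= C z) ->
  attains C (fun z => F z + (z == y) * m).
Proof.
move=> exy; elim: m C F => [|m IH] C F FC.
  by apply: attains_refl => z; have := FC z; lia.
apply: (attains_trans (F := fun z => F z + (z == x) * (m * 2) + (z == y))).
  by apply: attains_move exy _ => z; have := FC z; lia.
(* The pebble just brought to [y] joins the frame for the remaining [m] moves. *)
move=> C' FC'; have [|s [Cs Fs]] := IH C' (fun z => F z + (z == y)).
  by move=> z; have := FC' z; lia.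
by exists s; split=> // z; have := Fs z; lia.
Qed.

(** Each edge halves the number of pebbles carried, whence the factor [2 ^ size p]. *)
Lemma attains_path m C F x p : path e x p ->
  (forall z, F z + (z == x) * (m * 2 ^ size p) <= C z) ->
  attains C (fun z => F z + (z == last x p) * m).
Proof.
elim: p x C => [|y p IH] x C /= xp FC.
  by apply: attains_refl => z; have := FC z; rewrite muln1.
case/andP: xp => exy yp.
apply: (attains_trans (F := fun z => F z + (z == y) * (m * 2 ^ size p))).
  by apply: attains_edge exy _ => z; rewrite -mulnA -expnSr.
by move=> C'; apply: IH.
Qed.

End Attainable.

(** * The exact cost of covering from a single vertex *)

Section CoverCost.
Variables (T : finType) (e : rel T) (tree_e : is_tree e) (w : weight T).
Hypothesis w_gt0 : positive_weight w.
Local Notation d := (dist tree_e).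

Lemma attains_seq (m : T -> nat) (s : seq T) v (C : config T) (F : T -> nat) :
  (forall z, F z + (z == v) * (\sum_(u <- s) m u * 2 ^ d v u) <= C z) ->
  attains e C (fun z => F z + \sum_(u <- s) (z == u) * m u).
Proof.
elim: s C F => [|u s IH] C F FC.
  by apply: attains_refl => z; have := FC z; rewrite !big_nil; lia.
have [vu _] := andP (tpath_is_path tree_e v u).
(* While [u] is served, the frame reserves on [v] the pebbles meant for the rest of [s]. *)
pose F' z := F z + (z == v) * (\sum_(t <- s) m t * 2 ^ d v t).
have := attains_path (m := m u) (C := C) (F := F') vu.
rewrite last_tpath => /(_ _)/attains_trans; apply.
  by move=> z; have := FC z; rewrite /F' big_cons mulnDr addnA addnAC.
move=> C' FC'; have [|t [Ct Ft]] := IH C' (fun z => F z + (z == u) * m u).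
  by move=> z; have := FC' z; rewrite /F' addnAC.
by exists t; split=> // z; rewrite big_cons addnA.
Qed.

Definition cover_cost v := \sum_u `|w u|%N * 2 ^ d v u.

Lemma cover_cost_coverable v (C : config T) :
  cover_cost v <= C v -> coverable e w C.
Proof.
move=> vC; have [|s [Cs ws]] :=
    @attains_seq (fun u => `|w u|%N) (index_enum T) v C (fun=> 0).
  by move=> z; rewrite add0n; case: eqP => [->|]; rewrite ?mul1n.
exists s; split=> // z; have := ws z; rewrite add0n.
rewrite (bigD1_seq z) ?index_enum_uniq ?mem_index_enum //= eqxx.
by have := w_gt0 z; lia.
Qed.

(* Two pebbles at distance [n] weigh as much as one at distance [n + 1]. *)
Lemma pebbling_move_potential v (C C' : config T) : pebbling_move e C C' ->
  \sum_z C' z * 2 ^ d v z <= \sum_z C z * 2 ^ d v z.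
Proof.
case/existsP=> x /existsP[y /and3P[exy Cx /eqP ->]].
have single a t : \sum_z (a * (z == t)) * 2 ^ d v z = a * 2 ^ d v t.
  rewrite (bigD1 t) //= eqxx muln1 big1 ?addn0 // => z /negPf ->.
  by rewrite muln0.
(* The balance is stated with additions only, since subtraction on [nat] truncates. *)
have: \sum_z move_result C x y z * 2 ^ d v z + 2 * 2 ^ d v x
    = \sum_z C z * 2 ^ d v z + 1 * 2 ^ d v y.
  rewrite -!single -!big_split; apply: eq_bigr => z _ /=.
  rewrite -!mulnDl ffunE mul1n; congr (_ * _).
  by case: (eqVneq z x) => [->|_]; lia.
have : 2 ^ d v y <= 2 * 2 ^ d v x by rewrite -expnS leq_exp2l // dist_edge.
lia.
Qed.

(** The potential never grows along moves, and a configuration covering [w] has potential at least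
    [cover_cost v]. *)
Lemma coverable_cover_cost v (C : config T) :
  coverable e w C -> cover_cost v <= \sum_z C z * 2 ^ d v z.
Proof.
case=> s []; elim: s C => [|C' s IH] C /=.
  move=> _ wC; apply: leq_sum => z _; rewrite leq_mul2r.
  by apply/orP; right; have := w_gt0 z; have := wC z; lia.
by case/andP=> /(@pebbling_move_potential v) CC' Cs /(IH _ Cs) /leq_trans; apply.
Qed.

Lemma config_support1 v (C : config T) :
  config_support C = [set v] -> forall z, z != v -> C z = 0.
Proof.
move=> Cv z; have /setP/(_ z) := Cv.
by rewrite !inE lt0n => eqz zNv; move: eqz; rewrite (negPf zNv) => /negbFE/eqP.
Qed.

Lemma config_size1 v (C : config T) :
  config_support C = [set v] -> config_size C = C v.
Proof.
move/config_support1=> Cv.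
by rewrite /config_size (bigD1 v) //= big1 ?addn0 // => z /Cv.
Qed.

Lemma max_noncoverable_cost (C : config T) v :
  max_noncoverable_simple e w C -> config_support C = [set v] ->
  forall u, cover_cost u <= cover_cost v.
Proof.
move=> [[_ Cncov] Cmax] Cv u.
have Cv_gt0 : 0 < C v by have /setP/(_ v) := Cv; rewrite !inE eqxx.
have C_lt : C v < cover_cost v.
  by rewrite ltnNge; apply/negP => /cover_cost_coverable.
rewrite leqNgt; apply/negP => vu.
(* One pebble short of the cost at [u], hence noncoverable, yet at least [cover_cost v] pebbles and
   so more than [C] has. *)
pose C' : config T := [ffun z => (z == u) * (cover_cost u).-1].
have C'u : config_support C' = [set u].
  by apply/setP => z; rewrite !inE ffunE; case: eqP => _; lia.
have : config_size C' <= config_size C.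
  apply: Cmax; split; first by exists u.
  move/(coverable_cover_cost u); rewrite (bigD1 u) //= big1.
    2: by move=> z /(config_support1 C'u) ->.
  by rewrite ffunE eqxx distxx; lia.
by rewrite (config_size1 Cv) (config_size1 C'u) ffunE eqxx; lia.
Qed.

End CoverCost.

Theorem theorem8 (T : finType) (e : rel T) (w : weight T)
  (C : config T) (v : T) :
  is_tree e -> positive_weight w ->
  max_noncoverable_simple e w C -> config_support C = [set v] ->
  exists (x : T) (p : seq T), is_longest_path e x p /\ endpoint x p v.
Proof.
move=> tree_e w_gt0 Cmax Cv.
have cost_max := max_noncoverable_cost tree_e w_gt0 Cmax Cv.
have [[a b] _ diam] : {ab : T * T | true &
    forall x y, dist tree_e x y <= dist tree_e ab.1 ab.2}.
  pose f (xy : T * T) := dist tree_e xy.1 xy.2.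
  case: (@arg_maxnP _ (v, v) xpredT f isT) => ab _ max_ab.
  by exists ab => // x y; apply: (max_ab (x, y)).
rewrite /= in diam.
(* Either [v] has a vertex at diametral distance and starts a longest path, or the costs at [a] and
   [b] lead to a contradiction. *)
have [/existsP[c vc]|] := boolP [exists c, dist tree_e a b <= dist tree_e v c].
  exists v, (tpath tree_e v c); split; last by left.
  split=> [|y q yq]; first exact: tpath_is_path.
  by rewrite -(dist_last tree_e yq); apply: leq_trans (diam _ _) vc.
rewrite negb_exists => /forallP ecc.
have further u := dist_eccentric diam (fun c => etrans (ltnNge _ _) (ecc c)) u.
suff: cover_cost tree_e w v + cover_cost tree_e w v
    < cover_cost tree_e w a + cover_cost tree_e w b.
  by have := cost_max a; have := cost_max b; lia.
have term u : `|w u|%N * 2 ^ dist tree_e v u + `|w u|%N * 2 ^ dist tree_e v u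
    < `|w u|%N * 2 ^ dist tree_e a u + `|w u|%N * 2 ^ dist tree_e b u.
  rewrite -!mulnDr ltn_pmul2l; last by have := w_gt0 u; lia.
  (* The left side is now [2 ^ (d(v,u) + 1)], which one power on the right already reaches; the
     other power is positive, so the inequality is strict. *)
  rewrite addnn -mul2n -expnS.
  case: (further u) => far; have := leq_pexp2l (isT : 0 < 2) far;
    have := expn_gt0 2 (dist tree_e a u);
    have := expn_gt0 2 (dist tree_e b u); lia.
(* Splitting off the summand at [v] keeps one strict inequality; the others are weakened. *)
rewrite /cover_cost -!big_split /= (bigD1 v) //= [ltnRHS](bigD1 v) //=.
by rewrite -addSn leq_add // leq_sum // => u _; apply: ltnW.
Qed.
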